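(* Centered finite differencing in space preserves the anti-symmetric structure of the Hermite-discretized Vlasov advection operator $A_v^s(x,t)$, and thus that of the Vlasov advection operator. That is, replacing $\partial_x$ by the periodic centered finite difference matrix $\mathbf{D}^p$ on a uniform grid with $N_x$ points yields the semi-discrete system $\frac{\mathrm{d}}{\mathrm{d}t}\mathbf{\Psi}^s(t)=\mathbf{A}^s(t)\mathbf{\Psi}^s(t)$, $\mathbf{\Psi}^s(t)\in\mathbb{R}^{N_vN_x}$, where $\mathbf{A}^s(t)\in\mathbb{R}^{N_vN_x\times N_vN_x}$ is the block tridiagonal matrix (blocks of size $N_x\times N_x$ indexed by $n=0,\dots,N_v-1$) with $$\mathbf{A}^s_{n,n}=-u^s\mathbf{D}^p,\qquad \mathbf{A}^s_{n,n+1}=-\sqrt{\tfrac{n+1}{2}}\,\mathbf{G}_+^{s,p}(t),\qquad \mathbf{A}^s_{n,n-1}=\sqrt{\tfrac n2}\,\mathbf{G}_-^{s,p}(t),$$ $$\mathbf{G}_\pm^{s,p}(t)=\frac{q^s}{m^s\alpha^s}\,\mathrm{diag}(\mathbf{E}(t))\pm\alpha^s\mathbf{D}^p,$$ and this matrix is anti-symmetric: $\mathbf{A}^s(t)^\top=-\mathbf{A}^s(t)$.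
   Context: Vlasov advection operator: $A^s=-v\,\partial_x-\frac{q^s}{m^s}E(x,t)\,\partial_v$ with $x\in[0,\ell]$ periodic. Its symmetrically weighted Hermite discretization in velocity, with basis functions $\psi_n(\xi)=(\sqrt\pi2^nn!)^{-1/2}\mathcal H_n(\xi)e^{-\xi^2/2}$ ($\mathcal H_n$ physicists' Hermite polynomials, $\xi=(v-u^s)/\alpha^s$), closed by truncation, is the tridiagonal operator matrix $A_v^s$ with diagonal entries $-u^s\partial_x$, superdiagonal entries $-\sqrt{\frac{n+1}{2}}\left(\frac{q^s}{m^s\alpha^s}E+\alpha^s\partial_x\right)$ in position $(n,n+1)$, and subdiagonal entries $\sqrt{\frac n2}\left(\frac{q^s}{m^s\alpha^s}E-\alpha^s\partial_x\right)$ in position $(n,n-1)$, $0\le n\le N_v-1$. Here $q^s,u^s\in\mathbb{R}$, $m^s,\alpha^s>0$. $\mathbf{E}(t)=[E(x^{(1)},t),\dots,E(x^{(N_x)},t)]^\top\in\mathbb{R}^{N_x}$ is the vector of real electric field values on the uniform grid of spacing $\Delta x$, and $\mathbf{\Psi}^s(t)$ stacks $\mathbf{C}_0^s(t),\dots,\mathbf{C}_{N_v-1}^s(t)\in\mathbb{R}^{N_x}$, the grid values of the Hermite coefficients. $\mathbf{D}^p\in\mathbb{R}^{N_x\times N_x}$ is the periodic centered finite difference matrix of even order $p$ ($N_x>p$): the circulant matrix $\mathbf{D}^p_{jk}=d^p_{(k-j)\bmod N_x}$ with $d_0^p=0$; for $1\le k\le p/2=:r$, $d_k^p=\frac{1}{\Delta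 x}\frac{(-1)^{k+1}(r!)^2}{k\,(r-k)!\,(r+k)!}$ and $d_{N_x-k}^p=-d_k^p$; and all other $d^p_k=0$. (For $p=2$: $d_1=\frac{1}{2\Delta x}$; for $p=4$: $d_1=\frac{2}{3\Delta x}$, $d_2=-\frac{1}{12\Delta x}$.) *)

(* Defs.v *)
From HB Require Import structures.
From mathcomp Require Import all_boot all_order all_algebra.
From mathcomp Require Import all_classical all_reals all_analysis.
Set Implicit Arguments.
Unset Strict Implicit.
Unset Printing Implicit Defensive.
Import Order.TTheory GRing.Theory Num.Theory.
Import numFieldNormedType.Exports.
Local Open Scope classical_set_scope.
Local Open Scope ring_scope.

Section Antisymmetry.
Variables (R : realType) (V : Type).

Definition antisymmetric_operator (dom : V -> Prop) (ip : V -> V -> R)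
    (A : V -> V) : Prop :=
  forall f g : V, dom f -> dom g -> ip f (A g) = - ip (A f) g.

End Antisymmetry.

Section Vlasov.
Variable R : realType.
Implicit Types (l q m : R) (E : R -> R) (f g : R -> R -> R).

(* Phase-space functions are curried, [f x v]; [E] is the electric field at a
   fixed time. *)
Definition partial_x f (x v : R) : R := derive1 (fun y : R => f y v) x.
Definition partial_v f (x v : R) : R := derive1 (fun w : R => f x w) v.

Definition vlasov q m E f : R -> R -> R := fun x v =>
  - v * partial_x f x v - q / m * E x * partial_v f x v.

(* Continuously differentiable on the plane, [l]-periodic in [x], compactly
   supported in [v]. *)
Definition vlasov_dom l f : Prop :=
  [/\ forall x v, derivable (fun y : R => f y v) x 1 /\
                  derivable (fun w : R => f x w) v 1,
      continuous (fun z : R * R => partial_x f z.1 z.2),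
      continuous (fun z : R * R => partial_v f z.1 z.2),
      forall v, periodic (fun x : R => f x v) l
    & exists M : R, forall x v, M <= `|v| -> f x v = 0].

Definition vlasov_ip l f g : R :=
  \int[lebesgue_measure]_(x in `[0, l])
    (\int[lebesgue_measure]_(v in setT) (f x v * g x v)).

End Vlasov.

Section HermiteAdvection.
Variables (R : realType) (V : lmodType R).

(* The [(n, k)] entry of the operator matrix, applied to [c].  The spatial
   derivative [dx] and the multiplication [mulE] by the electric field are
   parameters, so that the spatially continuous operator and its discretization
   are instances of the same expression. *)
Definition hermite_entry (q m alpha u : R) (dx mulE : V -> V) (n k : nat)
    (c : V) : V :=
  if k == n then - u *: dx c
  else if k == n.+1 then
    - Num.sqrt (n.+1%:R / 2) *: ((q / (m * alpha)) *: mulE c + alpha *: dx c)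
  else if n == k.+1 then
    Num.sqrt (n%:R / 2) *: ((q / (m * alpha)) *: mulE c - alpha *: dx c)
  else 0.

(* Truncation closure: the sum only ranges over the indices [k < Nv]. *)
Definition hermite_advection (q m alpha u : R) (dx mulE : V -> V) (Nv : nat)
    (C : 'I_Nv -> V) : 'I_Nv -> V :=
  fun n => \sum_(k < Nv) hermite_entry q m alpha u dx mulE n k (C k).

End HermiteAdvection.

Section ContinuousHermite.
Variable R : realType.
Implicit Types (l : R) (E : R -> R).

Definition hermite_vlasov (q m alpha u : R) E (Nv : nat)
    (C : 'I_Nv -> (R -> R)) : 'I_Nv -> (R -> R) :=
  @hermite_advection R (R -> R) q m alpha u
    (fun c => derive1 c) (fun c x => E x * c x) Nv C.

Definition hermite_dom l (Nv : nat) (C : 'I_Nv -> (R -> R)) : Prop :=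
  forall n : 'I_Nv, [/\ forall x, derivable (C n) x 1,
                        continuous (derive1 (C n)) & periodic (C n) l].

Definition hermite_ip l (Nv : nat) (C B : 'I_Nv -> (R -> R)) : R :=
  \sum_(n < Nv) \int[lebesgue_measure]_(x in `[0, l]) (C n x * B n x).

End ContinuousHermite.

Section FiniteDifference.
Variable R : realType.

(* [d_k^p] for [1 <= k <= r], with [r = p / 2]. *)
Definition fd_weight (dx : R) (r k : nat) : R :=
  dx^-1 * (((-1) ^+ k.+1 * (r`!)%:R ^+ 2) /
           (k%:R * ((r - k)`!)%:R * ((r + k)`!)%:R)).

Definition fd_coef (dx : R) (p Nx k : nat) : R :=
  if (1 <= k <= p./2)%N then fd_weight dx p./2 k
  else if (1 <= Nx - k <= p./2)%N then - fd_weight dx p./2 (Nx - k)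
  else 0.

(* [k + (Nx - j)] represents [k - j] modulo [Nx] without truncation. *)
Definition fd_matrix (dx : R) (p Nx : nat) : 'M[R]_Nx :=
  \matrix_(j < Nx, k < Nx) fd_coef dx p Nx ((k + (Nx - j)) %% Nx)%N.

End FiniteDifference.

Section SemiDiscrete.
Variable R : realType.

Definition grid (x0 dx : R) (Nx : nat) (j : 'I_Nx) : R := x0 + j%:R * dx.

Definition field_vec (E : R -> R -> R) (x0 dx : R) (Nx : nat) (t : R)
    : 'rV[R]_Nx :=
  \row_(j < Nx) E (grid x0 dx j) t.

Definition hermite_fd (q m alpha u : R) (E : R -> R -> R) (x0 dx : R)
    (p Nx Nv : nat) (t : R) (C : 'I_Nv -> 'cV[R]_Nx) : 'I_Nv -> 'cV[R]_Nx :=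
  @hermite_advection R 'cV[R]_Nx q m alpha u
    (fun c => fd_matrix dx p Nx *m c)
    (fun c => \col_(j < Nx) (E (grid x0 dx j) t * c j 0)) Nv C.

Definition Gplus (q m alpha : R) (E : R -> R -> R) (x0 dx : R) (p Nx : nat)
    (t : R) : 'M[R]_Nx :=
  (q / (m * alpha)) *: diag_mx (field_vec E x0 dx Nx t)
    + alpha *: fd_matrix dx p Nx.

Definition Gminus (q m alpha : R) (E : R -> R -> R) (x0 dx : R) (p Nx : nat)
    (t : R) : 'M[R]_Nx :=
  (q / (m * alpha)) *: diag_mx (field_vec E x0 dx Nx t)
    - alpha *: fd_matrix dx p Nx.

Definition advection_block (q m alpha u : R) (E : R -> R -> R) (x0 dx : R)
    (p Nx : nat) (t : R) (n k : nat) : 'M[R]_Nx :=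
  if k == n then - u *: fd_matrix dx p Nx
  else if k == n.+1 then
    - Num.sqrt (n.+1%:R / 2) *: Gplus q m alpha E x0 dx p Nx t
  else if n == k.+1 then
    Num.sqrt (n%:R / 2) *: Gminus q m alpha E x0 dx p Nx t
  else 0.

(* The dimension [\sum_(n < Nv) Nx] is the library's size of a block matrix
   with [Nv] blocks of size [Nx]; it equals [Nv * Nx]. *)
Definition advection_matrix (q m alpha u : R) (E : R -> R -> R) (x0 dx : R)
    (p Nx Nv : nat) (t : R)
    : 'M[R]_(\sum_(n < Nv) Nx, \sum_(n < Nv) Nx) :=
  \mxblock_(n < Nv, k < Nv) advection_block q m alpha u E x0 dx p Nx t n k.

Definition stack (Nx Nv : nat) (C : 'I_Nv -> 'cV[R]_Nx)
    : 'cV[R]_(\sum_(n < Nv) Nx) :=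
  \mxcol_(n < Nv) C n.

End SemiDiscrete.

(* Main.v *)
Require Import Defs.
From HB Require Import structures.
From mathcomp Require Import all_boot all_order all_algebra.
From mathcomp Require Import all_classical all_reals all_analysis.
From mathcomp Require Import ring lra zify.
Set Implicit Arguments.
Unset Strict Implicit.
Unset Printing Implicit Defensive.
Import Order.TTheory GRing.Theory Num.Theory.
Import numFieldNormedType.Exports.
Local Open Scope classical_set_scope.
Local Open Scope ring_scope.

(** The anti-symmetry claims are continuous and discrete forms of one fact: the
    sum of the pairing of [f] with [A g] and of [A f] with [g] is the integral
    of a total derivative, which leaves no boundary term.

    On phase space, with [h = f * g], the sum [f * A g + A f * g] is
    [partial_x W + partial_v Z] for [W x v = - v * h x v] and
    [Z x v = - (q / m * E x) * h x v], because neither [v] nor [q / m * E x]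
    depends on the variable being differentiated.  The [Z] part integrates to
    zero over a segment in [v] outside which [f] and [g] vanish.  For the [W]
    part, no exchange of integrals is needed: the inner integral of
    [partial_x W] is the derivative of the [x]-periodic function
    [fun x => \int W x v] (differentiation under the integral sign), and the
    integral of that derivative over a period vanishes
    ([Rintegral_section_partial_x]).  Dominating the integrands requires [f] and
    [g] to be locally bounded; they are even jointly continuous, as a
    consequence of the continuity of their partial derivatives
    ([C1_continuous2]).

    For the Hermite system, the couplings of the modes [n] and [k] combine to a
    constant multiple of the derivative of [C n * B k]: the field terms of the
    superdiagonal cancel those of the subdiagonal, and the terms with a spatial
    derivative form a product rule ([hermite_entry_total_derivative]).

    For the discretization, the circulant matrix is anti-symmetric since its
    coefficients are odd modulo [Nx] ([fd_coefB]).  Transposition then turns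
    [Gplus] into [Gminus], so that the opposite signs of the super- and
    subdiagonal coefficients make the block matrix anti-symmetric.  The
    semi-discrete system is the stacked form of the mode equations because
    derivatives of matrix-valued functions are computed entrywise. *)

(** * The periodic finite difference matrix and the block matrix *)

Section FiniteDifferenceAntisymmetry.
Variable R : realType.
Implicit Types (dx q m alpha u t : R) (E : R -> R -> R) (p Nx Nv : nat).

(** The second branch of [fd_coef] would give a nonzero value at [0] if the
    stencil wrapped around the whole grid, which [p < Nx] rules out. *)
Lemma fd_coef0 dx p Nx : (p < Nx)%N -> fd_coef dx p Nx 0 = 0.
Proof.
by move=> pN; rewrite /fd_coef /= subn0 ifF//; apply/negP => /andP[_]; lia.
Qed.

(** Since [p < Nx], the indices [k <= p / 2] and [Nx - k <= p / 2] are
    exclusive: reflecting [k] swaps the two branches of [fd_coef]. *)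
Lemma fd_coefB dx p Nx k : (p < Nx)%N -> (0 < k < Nx)%N ->
  fd_coef dx p Nx (Nx - k) = - fd_coef dx p Nx k.
Proof.
move=> pN /andP[k0 kN]; rewrite /fd_coef subKn; last exact: ltnW.
have [kp|kp] := boolP (1 <= k <= p./2)%N.
  by rewrite ifF//; apply/negP => /andP[_]; move: kp => /andP[_]; lia.
by case: ifP => _; rewrite ?opprK ?oppr0.
Qed.

Lemma trmx_fd_matrix dx p Nx : (p < Nx)%N ->
  (fd_matrix dx p Nx)^T = - fd_matrix dx p Nx.
Proof.
move=> pN; apply/matrixP => j k; rewrite !mxE.
have [->|jk] := eqVneq j k.
  by rewrite addnC subnK 1?ltnW// modnn fd_coef0// oppr0.
have jkN : (j : nat) != k by [].
have jN := ltn_ord j; have kN := ltn_ord k.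
(* Transposition exchanges the residues of [k - j] and [j - k], which add up
   to [Nx] off the diagonal. *)
have mod_big a b : (a < b)%N -> (b < Nx)%N ->
    ((b + (Nx - a)) %% Nx = b - a)%N /\ ((a + (Nx - b)) %% Nx = Nx - (b - a))%N.
  move=> ab bN; split; last by rewrite modn_small; lia.
  by rewrite (_ : b + (Nx - a) = b - a + Nx)%N ?modnDr ?modn_small; lia.
have [lt_jk|lt_kj] : (j < k)%N \/ (k < j)%N by lia.
  have [-> ->] := mod_big _ _ lt_jk kN.
  by apply: fd_coefB => //; lia.
have [-> ->] := mod_big _ _ lt_kj jN.
by rewrite fd_coefB// ?opprK//; lia.
Qed.

(** Transposing the super- and subdiagonal blocks exchanges [Gplus] and
    [Gminus], and their coefficients in the two positions [(n, n + 1)] and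
    [(n + 1, n)] are opposite. *)
Lemma trmx_advection_block q m alpha u E x0 dx p Nx t (n k : nat) :
  (p < Nx)%N ->
  (advection_block q m alpha u E x0 dx p Nx t k n)^T =
  - advection_block q m alpha u E x0 dx p Nx t n k.
Proof.
move=> pN; have GE : (Gplus q m alpha E x0 dx p Nx t)^T =
    Gminus q m alpha E x0 dx p Nx t.
  by rewrite linearD/= !linearZ/= tr_diag_mx trmx_fd_matrix// scalerN.
have GE' : (Gminus q m alpha E x0 dx p Nx t)^T =
    Gplus q m alpha E x0 dx p Nx t by rewrite -GE trmxK.
have trZ a (M : 'M[R]_Nx) : (a *: M)^T = a *: M^T by rewrite linearZ.
rewrite /advection_block [n == k]eq_sym; case: (eqVneq k n) => [_|nk].
  by rewrite trZ trmx_fd_matrix// scalerN.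
case: (eqVneq n k.+1) => [->|nk1].
  by rewrite trZ GE scaleNr ifF//; lia.
case: (eqVneq k n.+1) => [->|_]; first by rewrite trZ GE' scaleNr opprK.
by rewrite trmx0 oppr0.
Qed.

Lemma trmx_advection_matrix q m alpha u E x0 dx p Nx Nv t : (p < Nx)%N ->
  (advection_matrix q m alpha u E x0 dx p Nx Nv t)^T =
  - advection_matrix q m alpha u E x0 dx p Nx Nv t.
Proof.
move=> pN; rewrite /advection_matrix tr_mxblock -mxblockN.
by apply/eq_mxblock => n k; apply: trmx_advection_block.
Qed.

End FiniteDifferenceAntisymmetry.

(** * The stacked system of ordinary differential equations *)

Section SemiDiscreteSystem.
Variable R : realType.
Implicit Types (dx q m alpha u t : R) (E : R -> R -> R) (p Nx Nv : nat).

Lemma is_derive_mxP (V : normedModType R) (a b : nat) (M : V -> 'M[R]_(a, b))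
    (x v : V) (D : 'M[R]_(a, b)) :
  is_derive x v M D <-> forall i j, is_derive x v (fun y => M y i j) (D i j).
Proof.
split=> [[dM <-] i j|dM].
  apply: DeriveDef; first by apply: (derivable_mxP _ _ _).1.
  by rewrite derive_mx// mxE.
have dM' : derivable M x v by apply/derivable_mxP => i j; have [] := dM i j.
apply: DeriveDef => //; rewrite derive_mx//; apply/matrixP => i j.
by rewrite mxE; have [] := dM i j.
Qed.

(** An entry of the stacked vector is an entry of one block, so both sides say
    the same about the entries. *)
Lemma is_derive_stack Nx Nv (C : R -> 'I_Nv -> 'cV[R]_Nx) t
    (D : 'I_Nv -> 'cV[R]_Nx) :
  (forall n, is_derive t 1 (fun s => C s n) (D n)) <->
  is_derive t 1 (fun s => stack (C s)) (stack D).
Proof.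
split=> dC.
  apply/is_derive_mxP => i j; rewrite mxE.
  under eq_fun do rewrite mxE.
  by have /is_derive_mxP := dC (tagnat.sig1 i); exact.
move=> n; apply/is_derive_mxP => i j; rewrite -(mxcolK D) mxE.
under eq_fun => s do rewrite -(mxcolK (C s)) mxE.
by have /is_derive_mxP := dC; exact.
Qed.

Lemma mul_diag_col n (d : 'rV[R]_n) (c : 'cV[R]_n) :
  diag_mx d *m c = \col_j (d 0 j * c j 0).
Proof. by apply/matrixP => i j; rewrite mul_diag_mx !mxE ord1. Qed.

Lemma advection_matrix_stack q m alpha u E x0 dx p Nx Nv t
    (C : 'I_Nv -> 'cV[R]_Nx) :
  advection_matrix q m alpha u E x0 dx p Nx Nv t *m stack C =
  stack (hermite_fd q m alpha u E x0 dx p t C).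
Proof.
rewrite /advection_matrix /stack mul_mxblock_mxrow; apply: eq_mxcol => n.
apply: eq_bigr => k _; rewrite /advection_block /hermite_entry.
have field (c : 'cV[R]_Nx) : \col_(j < Nx) (E (grid x0 dx j) t * c j 0) =
    diag_mx (field_vec E x0 dx Nx t) *m c.
  by rewrite mul_diag_col; apply/matrixP => i j; rewrite !mxE.
case: ifP => _; first by rewrite -scalemxAl.
case: ifP => _; first by rewrite field -scalemxAl mulmxDl -!scalemxAl.
case: ifP => _; first by rewrite field -scalemxAl mulmxBl -!scalemxAl.
by rewrite mul0mx.
Qed.

End SemiDiscreteSystem.

(** * Integrals of continuous functions over a segment *)

Section IntervalIntegral.
Variable R : realType.
Implicit Types (a b l : R) (f g : R -> R).
Notation mu := lebesgue_measure.

Lemma continuous_itv_integrable a b f :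
  continuous f -> mu.-integrable `[a, b] (EFin \o f).
Proof.
move=> cf; apply: continuous_compact_integrable; first exact: segment_compact.
exact: continuous_subspaceT.
Qed.

Lemma Rintegral_itvD a b f g : continuous f -> continuous g ->
  \int[mu]_(x in `[a, b]) (f x + g x) =
  \int[mu]_(x in `[a, b]) f x + \int[mu]_(x in `[a, b]) g x.
Proof.
by move=> cf cg; apply: RintegralD => //; apply: continuous_itv_integrable.
Qed.

Lemma continuous_sum (I : Type) (r : seq I) (F : I -> R -> R) :
  (forall i, continuous (F i)) -> continuous (fun x => \sum_(i <- r) F i x).
Proof.
move=> cF x; elim: r => [|i r IHr].
  by under eq_fun do rewrite big_nil; exact: cvg_cst.
under eq_fun do rewrite big_cons.
by apply: cvgD => //; exact: cF.
Qed.

Lemma Rintegral_itv_sum a b (I : Type) (r : seq I) (F : I -> R -> R) :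
  (forall i, continuous (F i)) ->
  \int[mu]_(x in `[a, b]) (\sum_(i <- r) F i x) =
  \sum_(i <- r) \int[mu]_(x in `[a, b]) F i x.
Proof.
move=> cF; elim: r => [|i r IHr].
  under eq_Rintegral do rewrite big_nil.
  by rewrite big_nil Rintegral_cst ?mul0r.
under eq_Rintegral do rewrite big_cons.
rewrite big_cons -IHr Rintegral_itvD//; exact: continuous_sum.
Qed.

Lemma Rintegral_itv_derive1 a b f : a < b -> (forall x, derivable f x 1) ->
  continuous (derive1 f) -> \int[mu]_(x in `[a, b]) derive1 f x = f b - f a.
Proof.
move=> ab df cf'.
have cf x : f y @[y --> x] --> f x.
  by apply: differentiable_continuous; apply/derivable1_diffP.
rewrite /Rintegral -[RHS]/(fine (f b - f a)%:E) EFinB; congr fine.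
apply: (continuous_FTC2 ab (continuous_subspaceT cf') _ _); last by [].
split=> [x _||]; first exact: df.
- exact: cvg_at_right_filter.
- exact: cvg_at_left_filter.
Qed.

Lemma Rintegral_derive1_periodic l f : 0 < l -> (forall x, derivable f x 1) ->
  continuous (derive1 f) -> periodic f l ->
  \int[mu]_(x in `[0, l]) derive1 f x = 0.
Proof.
move=> l0 df cf' fl; rewrite Rintegral_itv_derive1//.
by rewrite -[X in f X - _]add0r fl subrr.
Qed.

Lemma derive1M f g (x : R) : derivable f x 1 -> derivable g x 1 ->
  derive1 (f * g) x = f x * derive1 g x + g x * derive1 f x.
Proof. by move=> df dg; rewrite !derive1E; exact: (deriveM df dg). Qed.

Lemma derive1ZM (k : R) f g (x : R) : derivable f x 1 -> derivable g x 1 ->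
  derive1 (fun y => k * (f y * g y)) x =
  k * (f x * derive1 g x + g x * derive1 f x).
Proof.
move=> df dg; rewrite -derive1M//.
by rewrite -(@derive1Ml _ (f * g) x k (derivableM df dg)).
Qed.

Lemma derivableZM (k : R) f g (x : R) : derivable f x 1 -> derivable g x 1 ->
  derivable (fun y => k * (f y * g y)) x 1.
Proof.
move=> df dg; apply: (@derivableM _ _ (cst k) (f * g)).
  exact: derivable_cst.
exact: (derivableM df dg).
Qed.

End IntervalIntegral.

(** * The Hermite system with continuous space variable *)

Section ContinuousHermiteAntisymmetry.
Variable R : realType.
Implicit Types (l q m alpha u : R) (E : R -> R) (c b : R -> R) (Nv : nat).

(** The matrix of multiplication by [- v = - (u + alpha * xi)] in the Hermite
    basis, where [xi * psi n] is
    [sqrt ((n + 1) / 2) * psi (n + 1) + sqrt (n / 2) * psi (n - 1)]: the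
    Hermite form of the flux in [x] of the transport equation. *)
Definition hermite_flux alpha u (n k : nat) : R :=
  if k == n then - u
  else if k == n.+1 then - (alpha * Num.sqrt (n.+1%:R / 2))
  else if n == k.+1 then - (alpha * Num.sqrt (n%:R / 2))
  else 0.

Lemma hermite_entry_fctE q m alpha u (E : R -> R) (n k : nat) c x :
  @hermite_entry R (R -> R) q m alpha u
    (fun c => derive1 c) (fun c x => E x * c x) n k c x =
  if k == n then - u * derive1 c x
  else if k == n.+1 then
    - Num.sqrt (n.+1%:R / 2) *
      (q / (m * alpha) * (E x * c x) + alpha * derive1 c x)
  else if n == k.+1 then
    Num.sqrt (n%:R / 2) *
      (q / (m * alpha) * (E x * c x) - alpha * derive1 c x)
  else 0.
Proof. by rewrite /hermite_entry; do 3 case: ifP => // _. Qed.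

(** The entries [(n, k)] and [(k, n)] carry the field with opposite signs and
    the derivative with equal signs: the field cancels, and the product rule
    remains. *)
Lemma hermite_entry_total_derivative q m alpha u E (n k : nat) c b x :
  derivable c x 1 -> derivable b x 1 ->
  let entry := @hermite_entry R (R -> R) q m alpha u
    (fun c => derive1 c) (fun c x => E x * c x) in
  c x * entry n k b x + entry k n c x * b x =
  hermite_flux alpha u n k * derive1 (c * b) x.
Proof.
move=> dc db entry; rewrite derive1M// /entry !hermite_entry_fctE.
rewrite /hermite_flux [n == k]eq_sym.
move: (derive1 c x) (derive1 b x) (c x) (b x) => c' b' cx bx.
case: (eqVneq k n) => [_|nk]; first by ring.
case: (eqVneq k n.+1) => [->|nk1].
  by rewrite ifF; [ring|lia].
case: (eqVneq n k.+1) => [->|_]; first by ring.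
by rewrite mulr0 !mul0r addr0.
Qed.

Lemma hermite_vlasov_antisymmetric l q m alpha u E Nv : 0 < l ->
  continuous E ->
  antisymmetric_operator (@hermite_dom R l Nv) (@hermite_ip R l Nv)
    (@hermite_vlasov R q m alpha u E Nv).
Proof.
move=> l0 cE C B domC domB.
have cont (D : 'I_Nv -> R -> R) n : hermite_dom l D -> continuous (D n).
  move=> domD x; apply: differentiable_continuous; apply/derivable1_diffP.
  by have [] := domD n.
have cont' (D : 'I_Nv -> R -> R) n : hermite_dom l D ->
    continuous (derive1 (D n)).
  by move=> domD; have [] := domD n.
pose entry := @hermite_entry R (R -> R) q m alpha u
    (fun c => derive1 c) (fun c x => E x * c x).
have cont_entry (D : 'I_Nv -> R -> R) i j n : hermite_dom l D ->
    continuous (entry i j (D n)).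
  move=> domD x.
  rewrite /continuous_at (_ : entry i j (D n) = fun x => entry i j (D n) x)//.
  under eq_fun do rewrite /entry hermite_entry_fctE.
  rewrite /entry hermite_entry_fctE.
  have EDx : E y * D n y @[y --> x] --> E x * D n x.
    by apply: cvgM; [exact: cE|exact: cont].
  have dDx := cont' D n domD x.
  case: ifP => _; first exact: (cvgM (cvg_cst _) dDx).
  case: ifP => _.
    apply: (cvgM (cvg_cst _)).
    exact: (cvgD (cvgM (cvg_cst _) EDx) (cvgM (cvg_cst _) dDx)).
  case: ifP => _; last exact: cvg_cst.
  apply: (cvgM (cvg_cst _)).
  exact: (cvgB (cvgM (cvg_cst _) EDx) (cvgM (cvg_cst _) dDx)).
have total (n k : 'I_Nv) : \int[lebesgue_measure]_(x in `[0, l])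
      (C n x * entry n k (B k) x) +
    \int[lebesgue_measure]_(x in `[0, l]) (entry k n (C n) x * B k x) = 0.
  have [dC _ pC] := domC n; have [dB _ pB] := domB k.
  rewrite -Rintegral_itvD; first last.
  - by move=> x; apply: cvgM; [exact: cont_entry|exact: cont].
  - by move=> x; apply: cvgM; [exact: cont|exact: cont_entry].
  have cCB : continuous (derive1 (C n * B k)).
    rewrite (_ : derive1 _ = fun x => C n x * derive1 (B k) x +
        B k x * derive1 (C n) x); last by apply/funext => x; exact: derive1M.
    by move=> x; apply: cvgD; apply: cvgM;
      by [exact: cont|exact: cont'].
  under eq_Rintegral => x _.
    rewrite hermite_entry_total_derivative; [|exact: dC|exact: dB].
    over.
  rewrite RintegralZl//; last exact: continuous_itv_integrable.
  have dCB x : derivable (C n * B k) x 1 by exact: (derivableM (dC x) (dB x)).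
  have pCB : periodic (C n * B k) l by move=> x; rewrite !fctE pC pB.
  by rewrite (Rintegral_derive1_periodic l0 dCB cCB pCB) mulr0.
apply/eqP; rewrite -addr_eq0 /hermite_ip; apply/eqP.
have sumL n : \int[lebesgue_measure]_(x in `[0, l])
      (C n x * hermite_vlasov q m alpha u E B n x) =
    \sum_(k < Nv) \int[lebesgue_measure]_(x in `[0, l])
      (C n x * entry n k (B k) x).
  rewrite -Rintegral_itv_sum; last first.
    by move=> k x; apply: cvgM; [exact: cont|exact: cont_entry].
  by apply: eq_Rintegral => x _; rewrite /hermite_vlasov /hermite_advection
    fct_sumE mulr_sumr.
have sumR n : \int[lebesgue_measure]_(x in `[0, l])
      (hermite_vlasov q m alpha u E C n x * B n x) =
    \sum_(k < Nv) \int[lebesgue_measure]_(x in `[0, l])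
      (entry n k (C k) x * B n x).
  rewrite -Rintegral_itv_sum; last first.
    by move=> k x; apply: cvgM; [exact: cont_entry|exact: cont].
  by apply: eq_Rintegral => x _; rewrite /hermite_vlasov /hermite_advection
    fct_sumE mulr_suml.
under eq_bigr do rewrite sumL.
under [X in _ + X]eq_bigr do rewrite sumR.
(* The second double sum is reindexed so that the entry [(k, n)] acting on
   [C n] meets the entry [(n, k)] acting on [B k]. *)
rewrite [X in _ + X]exchange_big -big_split big1// => n _.
by rewrite -big_split big1// => k _; exact: total.
Qed.

End ContinuousHermiteAntisymmetry.

(** * Jointly continuous functions on the plane *)

Section PlaneFunctions.
Variable R : realType.
Implicit Types (F f g : R -> R -> R).
Notation mu := lebesgue_measure.
Definition continuous2 F : Prop := continuous (fun z : R * R => F z.1 z.2).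

Lemma continuous2_sectionr F x : continuous2 F -> continuous (F x).
Proof.
move=> cF v.
apply: (@continuous_comp _ _ _ (pair x) (fun z : R * R => F z.1 z.2));
  last exact: cF.
exact: (cvg_pair (cvg_cst x) cvg_id).
Qed.

Lemma continuous2_sectionl F v : continuous2 F -> continuous (F^~ v).
Proof.
move=> cF x.
apply: (@continuous_comp _ _ _ (pair^~ v) (fun z : R * R => F z.1 z.2));
  last exact: cF.
exact: (cvg_pair cvg_id (cvg_cst v)).
Qed.

Lemma continuous2M f g : continuous2 f -> continuous2 g ->
  continuous2 (fun x v => f x v * g x v).
Proof. by move=> cf cg z; apply: cvgM; [exact: cf|exact: cg]. Qed.

Lemma continuous2D f g : continuous2 f -> continuous2 g ->
  continuous2 (fun x v => f x v + g x v).
Proof. by move=> cf cg z; apply: cvgD; [exact: cf|exact: cg]. Qed.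

Lemma continuous2B f g : continuous2 f -> continuous2 g ->
  continuous2 (fun x v => f x v - g x v).
Proof. by move=> cf cg z; apply: cvgB; [exact: cf|exact: cg]. Qed.

Lemma continuous2_fst (a : R -> R) : continuous a ->
  continuous2 (fun x v => a x).
Proof.
move=> ca z; apply: (@continuous_comp _ _ _ fst a); last exact: ca.
by case: z => x v; exact: cvg_fst.
Qed.

Lemma continuous2_snd (a : R -> R) : continuous a ->
  continuous2 (fun x v => a v).
Proof.
move=> ca z; apply: (@continuous_comp _ _ _ snd a); last exact: ca.
by case: z => x v; exact: cvg_snd.
Qed.

Lemma continuous2_bounded F a b c d : continuous2 F ->
  exists2 M, 0 <= M & forall x v, a <= x <= b -> c <= v <= d ->
    `|F x v| <= M.
Proof.
move=> cF; have cK : compact (`[a, b]%classic `*` `[c, d]%classic).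
  by apply: compact_setX; exact: segment_compact.
have := continuous_compact (continuous_subspaceT cF) cK.
move=> /compact_bounded[M [_ MF]].
exists (Num.max 0 M + 1).
  by rewrite addr_ge0// le_max lexx.
move=> x v xab vcd; apply: (MF (Num.max 0 M + 1)).
  by rewrite (@le_lt_trans _ _ (Num.max 0 M)) ?ltrDl// le_max lexx orbT.
by exists (x, v) => //=; split; rewrite /= in_itv.
Qed.

(** Near a point, the slope of [f] in [v] is bounded uniformly in [x], because
    [partial_v f] is bounded on a square; hence [f x v] is close to [f x b],
    which is close to [f a b] by continuity in [x] alone. *)
Lemma C1_continuous2 f :
  (forall x v, derivable (f^~ v) x 1) -> (forall x v, derivable (f x) v 1) ->
  continuous2 (partial_v f) -> continuous2 f.
Proof.
move=> dx dv cv [a b].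
have [K K0 bK] := continuous2_bounded (a - 1) (a + 1) (b - 1) (b + 1) cv.
have lip x v : `|x - a| <= 1 -> `|v - b| <= 1 ->
    `|f x v - f x b| <= K * `|v - b|.
  move=> xa1 vb1; have /andP[xa ax] : -1 <= x - a <= 1 by rewrite -ler_norml.
  have /andP[vb bv] : -1 <= v - b <= 1 by rewrite -ler_norml.
  have mvt r s : r <= s -> b - 1 <= r -> s <= b + 1 ->
      `|f x s - f x r| <= K * `|s - r|.
    move=> rs br sb.
    have [||w wrs ->] := @MVT_segment R (f x) (partial_v f x) r s rs.
    - by move=> w _; apply: DeriveDef => //; rewrite /partial_v derive1E.
    - by apply: derivable_within_continuous => w _; exact: dv.
    rewrite normrM ler_wpM2r// bK//; first by apply/andP; split; lra.
    by move: wrs; rewrite in_itv/= => /andP[rw ws]; apply/andP; split; lra.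
  have [le_vb|lt_bv] := leP v b; last by apply: mvt; lra.
  by rewrite (distrC v) (distrC (f x v)) mvt//; lra.
apply/cvgrPdist_le => e e0 /=.
have cb : f y b @[y --> a] --> f a b.
  by apply: differentiable_continuous; apply/derivable1_diffP/dx.
have e2 : 0 < e / 2 by lra.
(* [K + 1] instead of [K] since [K] may vanish. *)
have K1 : 0 < Num.min 1 (e / 2 / (K + 1)).
  by rewrite lt_min ltr01 divr_gt0//; lra.
have fst_a : z.1 @[z --> (a, b)] --> a by exact: cvg_fst.
have snd_b : z.2 @[z --> (a, b)] --> b by exact: cvg_snd.
have fb_a : f z.1 b @[z --> (a, b)] --> f a b.
  exact: (cvg_comp fst (f^~ b) fst_a cb).
near=> z.
have za : `|z.1 - a| <= 1.
  by rewrite distrC; near: z; exact: (cvgrPdist_le _ _).1 fst_a 1 ltr01.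
have zb : `|z.2 - b| <= Num.min 1 (e / 2 / (K + 1)).
  by rewrite distrC; near: z; exact: (cvgrPdist_le _ _).1 snd_b _ K1.
have fza : `|f a b - f z.1 b| <= e / 2.
  by near: z; exact: (cvgrPdist_le _ _).1 fb_a _ e2.
move: zb; rewrite le_min => /andP[zb1 zbK].
rewrite (le_trans (ler_distD (f z.1 b) _ _))// (splitr e) lerD//.
rewrite distrC (le_trans (lip _ _ za zb1))//.
rewrite (@le_trans _ _ (K * (e / 2 / (K + 1))))// ?ler_wpM2l//.
by rewrite mulrCA ger_pMr// ler_pdivrMr ?mul1r; lra.
Unshelve. all: by end_near. Qed.

(** A jointly continuous integrand is dominated by a constant for [x] in a
    bounded interval. *)
Lemma continuous_Rintegral_section F c d : continuous2 F ->
  continuous (fun x => \int[mu]_(v in `[c, d]) F x v).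
Proof.
move=> cF x.
have [M M0 bM] := continuous2_bounded (x - 1) (x + 1) c d cF.
apply: (@continuity_under_integral R _ _ mu F `[c, d] _ (x - 1) (x + 1) _ _
  (cst M)) => //.
- by move=> y _; apply: continuous_itv_integrable; exact: continuous2_sectionr.
- by apply/aeW => v _ y _; exact: continuous2_sectionl.
- by apply: continuous_itv_integrable => v; exact: cvg_cst.
- move=> y; rewrite /= in_itv/= => /andP[xy yx]; apply/aeW => v.
  by rewrite /= in_itv/= => vcd; apply: bM => //; rewrite !ltW.
- by rewrite inE/= in_itv/=; apply/andP; split; lra.
Qed.

Lemma derive_Rintegral_section F c d (x : R) : continuous2 F ->
  (forall x v, derivable (F^~ v) x 1) -> continuous2 (partial_x F) ->
  derivable (fun x => \int[mu]_(v in `[c, d]) F x v) x 1 /\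
  derive1 (fun x => \int[mu]_(v in `[c, d]) F x v) x =
    \int[mu]_(v in `[c, d]) partial_x F x v.
Proof.
move=> cF dF cF'.
have [M M0 bM] := continuous2_bounded (x - 1) (x + 1) c d cF'.
have Ix : [set` `]x - 1, x + 1[] x.
  by rewrite /= in_itv/=; apply/andP; split; lra.
have intF y : [set` `]x - 1, x + 1[] y -> mu.-integrable `[c, d] (EFin \o F y).
  by move=> _; apply: continuous_itv_integrable; exact: continuous2_sectionr.
have intM : mu.-integrable `[c, d] (EFin \o cst M).
  by apply: continuous_itv_integrable => v; exact: cvg_cst.
have ubM y v : [set` `]x - 1, x + 1[] y -> `[c, d]%classic v ->
    `|partial1of2 F y v| <= cst M v.
  rewrite /= !in_itv/= => /andP[xy yx] vcd.
  by apply: (bM y v) => //; rewrite !ltW.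
have dF' y v : [set` `]x - 1, x + 1[] y -> `[c, d]%classic v ->
  derivable (F^~ v) y 1 by [].
have mI : measurable `[c, d]%classic by exact: measurable_itv.
split.
  exact: (@derivable_under_integral R _ _ mu F _ mI x _ _ Ix intF dF'
    (cst M) (fun=> M0) intM ubM).
exact: (@differentiation_under_integral R _ _ mu F _ mI x _ _ Ix intF dF'
  (cst M) (fun=> M0) intM ubM).
Qed.

(** The inner integral of [partial_x F] is the derivative of a periodic
    function, so its integral over a period vanishes. *)
Lemma Rintegral_section_partial_x l c d F : 0 < l -> continuous2 F ->
  (forall x v, derivable (F^~ v) x 1) -> continuous2 (partial_x F) ->
  (forall v, periodic (F^~ v) l) ->
  \int[mu]_(x in `[0, l]) \int[mu]_(v in `[c, d]) partial_x F x v = 0.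
Proof.
move=> l0 cF dF cF' pF.
pose H x := \int[mu]_(v in `[c, d]) F x v.
have dH x := derive_Rintegral_section c d x cF dF cF'.
have H'E : derive1 H = fun x => \int[mu]_(v in `[c, d]) partial_x F x v.
  by apply/funext => x; exact: (dH x).2.
rewrite -H'E; apply: Rintegral_derive1_periodic => //.
- by move=> x; exact: (dH x).1.
- by rewrite H'E; exact: continuous_Rintegral_section.
- by move=> x; apply: eq_Rintegral => v _; exact: pF.
Qed.

End PlaneFunctions.

(** * The Vlasov operator *)

Section VlasovAntisymmetry.
Variable R : realType.
Implicit Types (l q m : R) (E : R -> R) (f g : R -> R -> R).
Notation mu := lebesgue_measure.

Lemma Rintegral_bounded_support M (F : R -> R) :
  (forall v, M <= `|v| -> F v = 0) ->
  \int[mu]_(v in setT) F v = \int[mu]_(v in `[- M, M]) F v.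
Proof.
move=> F0; rewrite [RHS]Rintegral_mkcond; congr (Rintegral _ _ _).
apply/funext => v; rewrite patchE; case: ifPn => // vM.
apply: F0; rewrite leNgt; apply: contra vM => vM.
by rewrite inE/= in_itv/= -ler_norml ltW.
Qed.

Lemma vlasov_antisymmetric l q m E : 0 < l -> continuous E ->
  antisymmetric_operator (vlasov_dom l) (vlasov_ip l) (vlasov q m E).
Proof.
move=> l0 cE f g [df cfx cfv pf [Mf f0]] [dg cgx cgv pg [Mg g0]].
have fx x v := (df x v).1; have fv x v := (df x v).2.
have gx x v := (dg x v).1; have gv x v := (dg x v).2.
have cf : continuous2 f := C1_continuous2 fx fv cfv.
have cg : continuous2 g := C1_continuous2 gx gv cgv.
have cN : continuous2 (fun _ v : R => - v).
  apply: (continuous2_snd (a := fun v => - v)) => v.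
  by apply: cvgN; exact: cvg_id.
have cqE : continuous2 (fun x _ : R => q / m * E x).
  apply: (continuous2_fst (a := fun x => q / m * E x)) => x.
  by apply: cvgM; [exact: cvg_cst|exact: cE].
have cvl (h : R -> R -> R) : continuous2 (partial_x h) ->
    continuous2 (partial_v h) -> continuous2 (vlasov q m E h).
  move=> chx chv.
  exact: (continuous2B (continuous2M cN chx) (continuous2M cqE chv)).
have cfAg := continuous2M cf (cvl g cgx cgv).
have cAfg := continuous2M (cvl f cfx cfv) cg.
have cfAg_x (x : R) : continuous (fun v : R => f x v * vlasov q m E g x v).
  exact: (continuous2_sectionr (x := x) cfAg).
have cAfg_x (x : R) : continuous (fun v : R => vlasov q m E f x v * g x v).
  exact: (continuous2_sectionr (x := x) cAfg).
pose M := `|Mf| + `|Mg| + 1.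
have [MfM MgM M0] : [/\ Mf <= M, Mg <= M & 0 < M].
  have := ler_norm Mf; have := ler_norm Mg.
  have := normr_ge0 Mf; have := normr_ge0 Mg.
  by rewrite /M => ? ? ? ?; split; lra.
have f0M x v : M <= `|v| -> f x v = 0.
  by move=> vM; apply: f0; exact: le_trans vM.
have g0M x v : M <= `|v| -> g x v = 0.
  by move=> vM; apply: g0; exact: le_trans vM.
(* The two fluxes: [f * A g + A f * g = partial_x W + partial_v Z]. *)
pose W (x v : R) : R := - v * (f x v * g x v).
pose Z (x v : R) : R := - (q / m * E x) * (f x v * g x v).
have cW : continuous2 W := continuous2M cN (continuous2M cf cg).
have WxE : partial_x W = fun x v =>
    - v * (f x v * partial_x g x v + g x v * partial_x f x v).
  apply/funext => x; apply/funext => v.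
  exact: (derive1ZM (- v) (fx x v) (gx x v)).
have cWx : continuous2 (partial_x W).
  rewrite WxE; apply: (continuous2M cN).
  exact: (continuous2D (continuous2M cf cgx) (continuous2M cg cfx)).
have dW (x v : R) : derivable (W^~ v) x 1.
  exact: (derivableZM (fx x v) (gx x v)).
have ZvE x : derive1 (Z x) = fun v =>
    - (q / m * E x) * (f x v * partial_v g x v + g x v * partial_v f x v).
  by apply/funext => v; exact: (derive1ZM _ (fv x v) (gv x v)).
have cZv x : continuous (derive1 (Z x)).
  rewrite ZvE => v; apply: cvgM; first exact: cvg_cst.
  by apply: cvgD; apply: cvgM; exact: continuous2_sectionr.
have dZ (x v : R) : derivable (Z x) v 1.
  exact: (derivableZM (fv x v) (gv x v)).
have intZ x : \int[mu]_(v in `[- M, M]) derive1 (Z x) v = 0.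
  rewrite Rintegral_itv_derive1//; last lra.
  by rewrite /Z !f0M ?normrN ?ler_norm// !mul0r !mulr0 subrr.
apply/eqP; rewrite -addr_eq0 /vlasov_ip; apply/eqP.
have restrict F1 F2 x : (forall v, M <= `|v| -> F1 x v * F2 x v = 0) ->
    \int[mu]_(v in setT) (F1 x v * F2 x v) =
    \int[mu]_(v in `[- M, M]) (F1 x v * F2 x v).
  exact: Rintegral_bounded_support.
under eq_Rintegral => x _.
  rewrite restrict; last by move=> v vM; rewrite f0M ?mul0r.
  over.
under [X in _ + X]eq_Rintegral => x _.
  rewrite restrict; last by move=> v vM; rewrite g0M ?mulr0.
  over.
rewrite -Rintegral_itvD; first last.
- exact: (continuous_Rintegral_section (c := - M) (d := M) cAfg).
- exact: (continuous_Rintegral_section (c := - M) (d := M) cfAg).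
rewrite -[RHS](Rintegral_section_partial_x (- M) M l0 cW dW cWx); last first.
  by move=> v x; rewrite /W pf pg.
apply: eq_Rintegral => x _.
rewrite -Rintegral_itvD; [|exact: cfAg_x|exact: cAfg_x].
rewrite -[RHS]addr0 -(intZ x) -Rintegral_itvD//; last first.
  exact: continuous2_sectionr.
by apply: eq_Rintegral => v _; rewrite WxE ZvE /vlasov; ring.
Qed.

End VlasovAntisymmetry.

Theorem theorem3 (R : realType)
  (l : R) (hl : 0 < l)
  (q m alpha u : R) (hm : 0 < m) (halpha : 0 < alpha)
  (E : R -> R -> R)
  (Nv Nx p : nat) (hp0 : (0 < p)%N) (hp : ~~ odd p) (hNx : (p < Nx)%N)
  (x0 dx : R) (hdx : dx * Nx%:R = l) :
  [/\ forall t : R, continuous (fun x : R => E x t) ->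
        antisymmetric_operator (vlasov_dom l) (vlasov_ip l)
          (vlasov q m (fun x => E x t)),
      forall t : R, continuous (fun x : R => E x t) ->
        antisymmetric_operator (@hermite_dom R l Nv) (@hermite_ip R l Nv)
          (@hermite_vlasov R q m alpha u (fun x => E x t) Nv),
      forall (C : R -> 'I_Nv -> 'cV[R]_Nx) (t : R),
        (forall n : 'I_Nv,
           is_derive t 1 (fun s : R => C s n)
             (hermite_fd q m alpha u E x0 dx p t (C t) n)) <->
        is_derive t 1 (fun s : R => stack (C s))
          (advection_matrix q m alpha u E x0 dx p Nx Nv t *m stack (C t))
    & forall t : R,
        (advection_matrix q m alpha u E x0 dx p Nx Nv t)^T =
        - advection_matrix q m alpha u E x0 dx p Nx Nv t].
Proof.
split.
- by move=> t cE; exact: vlasov_antisymmetric.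
- by move=> t cE; exact: hermite_vlasov_antisymmetric.
- by move=> C t; rewrite advection_matrix_stack; exact: is_derive_stack.
- by move=> t; exact: trmx_advection_matrix.
Qed.
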